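(* Let $w\in\mathbb{C}$ be fixed and $n\ge 4$. For $1\le l<j<r\le n$ let $f_{n,l,j,r}=\frac12\left(w^{j-l}+w^{r-j}\right)$ if the triangle with vertices $v_{n,l},v_{n,j},v_{n,r}$ has exactly one side in common with the perimeter of the convex $n$-gon $P_n$, and $f_{n,l,j,r}=0$ otherwise. Let $\mathcal{S}_n$ be the sum of the weights $f_{n,l,j,r}$ over all triangles of a uniformly random triangulation of $P_n$. Then $$\mathbb{E}(\mathcal{S}_n)=-\frac{(n-1)(2w^{n-2}+3w)}{2(2n-5)}+\frac{3w}{C_{n-2}}\sum_{j=0}^{n-3}w^jC_j\binom{2n-6-2j}{n-3-j}-\frac{w}{2C_{n-2}}\sum_{j=0}^{n-3}w^jC_j\binom{2n-4-2j}{n-2-j}.$$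
   Context: $P_n$ is a convex polygon with vertices $v_{n,1},\dots,v_{n,n}$ in clockwise order (so its sides are $v_{n,i}v_{n,i+1}$ for $1\le i\le n-1$, together with $v_{n,1}v_{n,n}$). A triangulation of $P_n$ is a set of $n-3$ noncrossing diagonals partitioning $P_n$ into $n-2$ triangles; there are $C_{n-2}$ of them, where $C_k=\frac{1}{k+1}\binom{2k}{k}$, and the random triangulation is chosen uniformly among them. $w^0=1$. *)

(* Defs.v *)
(* R : realType models the real numbers, R[i] the complex
   numbers, R * R the plane.  The vertex v_{n,i} (1 <= i <= n) is v applied to
   the ordinal of value i - 1; only differences of indices and the cyclic order
   of the vertices matter below. *)
From mathcomp Require Import all_boot all_order all_algebra.
From mathcomp Require Import boolp reals.
From mathcomp Require Export complex.
Set Implicit Arguments.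
Unset Strict Implicit.
Unset Printing Implicit Defensive.
Import Order.TTheory GRing.Theory Num.Theory.
Local Open Scope ring_scope.
Local Open Scope complex_scope.

(* Twice the signed area of the triangle a b c: it is negative iff a, b, c turn
   clockwise, i.e. iff c lies strictly to the right of the line from a to b. *)
Definition orient (R : realType) (a b c : R * R) : R :=
  (b.1 - a.1) * (c.2 - a.2) - (b.2 - a.2) * (c.1 - a.1).

(* The v i are the vertices, in clockwise order, of a convex polygon (with no
   three vertices on a line). *)
Definition convex_clockwise (R : realType) n (v : 'I_n -> R * R) : Prop :=
  forall i j k : 'I_n, (i < j < k)%N -> orient (v i) (v j) (v k) < 0.

(* The closed region bounded by a convex clockwise polygon: the intersection of
   the half-planes to the right of its sides (ordS is the cyclic successor). *)
Definition in_polygon (R : realType) n (v : 'I_n -> R * R) (p : R * R) : Prop :=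
  forall i : 'I_n, orient (v i) (v (ordS i)) p <= 0.

(* Sides and diagonals are given by their end points (i, j) with i < j, and
   triangles by their vertices (l, j, r) with l < j < r. *)
Definition side n (i j : 'I_n) : bool :=
  ((j == i.+1 :> nat) || (i == 0 :> nat) && (j == n.-1 :> nat))%N.

Definition diagonal n (d : 'I_n * 'I_n) : bool :=
  (d.1 < d.2)%N && ~~ side d.1 d.2.

Definition in_open_segment (R : realType) (a b p : R * R) : Prop :=
  exists t : R, [/\ 0 < t < 1,
    p.1 = (1 - t) * a.1 + t * b.1 & p.2 = (1 - t) * a.2 + t * b.2].

Definition crossing (R : realType) n (v : 'I_n -> R * R)
    (d e : 'I_n * 'I_n) : Prop :=
  exists p : R * R, in_open_segment (v d.1) (v d.2) p /\
                    in_open_segment (v e.1) (v e.2) p.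

Definition edge n (T : {set 'I_n * 'I_n}) (i j : 'I_n) : bool :=
  side i j || ((i, j) \in T).

(* When the diagonals in T do not cross, a vertex triple joined by edges bounds
   a single face: by convexity no vertex, hence no diagonal, enters it. *)
Definition triangles n (T : {set 'I_n * 'I_n}) : {set 'I_n * 'I_n * 'I_n} :=
  [set t : 'I_n * 'I_n * 'I_n | let: (l, j, r) := t in
    [&& l < j, j < r, edge T l j, edge T j r & edge T l r]%N].

Definition in_triangle (R : realType) n (v : 'I_n -> R * R)
    (t : 'I_n * 'I_n * 'I_n) (p : R * R) : Prop :=
  let: (l, j, r) := t in
  [/\ orient (v l) (v j) p <= 0, orient (v j) (v r) p <= 0
    & orient (v r) (v l) p <= 0].

Definition in_triangle_interior (R : realType) n (v : 'I_n -> R * R)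
    (t : 'I_n * 'I_n * 'I_n) (p : R * R) : Prop :=
  let: (l, j, r) := t in
  [/\ orient (v l) (v j) p < 0, orient (v j) (v r) p < 0
    & orient (v r) (v l) p < 0].

Definition partitions_polygon (R : realType) n (v : 'I_n -> R * R)
    (A : {set 'I_n * 'I_n * 'I_n}) : Prop :=
  (forall p, in_polygon v p -> exists2 t, t \in A & in_triangle v t p) /\
  (forall p t t', t \in A -> t' \in A ->
     in_triangle_interior v t p -> in_triangle_interior v t' p -> t = t').

Definition is_triangulation (R : realType) n (v : 'I_n -> R * R)
    (T : {set 'I_n * 'I_n}) : Prop :=
  [/\ forall d, d \in T -> diagonal d,
      #|T| = (n - 3)%N,
      forall d e, d \in T -> e \in T -> d != e -> ~ crossing v d e,
      #|triangles T| = (n - 2)%N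
    & partitions_polygon v (triangles T)].

Definition triangulations (R : realType) n (v : 'I_n -> R * R) :
    {set {set 'I_n * 'I_n}} :=
  [set T | `[< is_triangulation v T >]].

Definition uniform_expectation (R : realType) (I : finType) (Omega : {set I})
    (X : I -> R[i]) : R[i] :=
  (\sum_(x in Omega) X x) / #|Omega|%:R.

Definition catalan (R : realType) (k : nat) : R[i] :=
  (k.+1%:R)^-1 * ('C(2 * k, k))%:R.

Definition perimeter_sides n (l j r : 'I_n) : nat :=
  (side l j + side j r + side l r)%N.

Definition weight (R : realType) (w : R[i]) n (l j r : 'I_n) : R[i] :=
  if perimeter_sides l j r == 1%N
  then 2^-1 * (w ^+ (j - l)%N + w ^+ (r - j)%N) else 0.

Definition total_weight (R : realType) (w : R[i]) n
    (T : {set 'I_n * 'I_n}) : R[i] :=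
  \sum_(t in triangles T) (let: (l, j, r) := t in weight w l j r).

(* Main.v *)
(* Adding the side (0, n - 1) to a triangulation turns it into a noncrossing set
   of chords of maximal size j - i - 1 on a range [i, j] of vertices.  Removing
   the triangle on the base (i, j), with apex k, splits such a set into one on
   [i, k] and one on [k, j]; so the numbers of these sets have generating
   function c with c = x + c^2 (shifted Catalan numbers), and the generating
   function s of the total weights on ranges other than [0, n - 1] satisfies
   s = G + 2 c s, where G accounts for the base triangle.  Since
   1 - 2 c = (1 - 4 x)^(1/2) = 1 / B with B the generating function of the
   central binomial coefficients, s = G B; on the range [0, n - 1] only the
   weight of the base triangle changes, which gives G0 + 2 c s = G0 + G B - G.
   All series are handled as polynomials modulo x^n. *)
Require Import Defs.
From mathcomp Require Import all_boot all_order all_algebra.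
From mathcomp Require Import ring lra zify.
From mathcomp Require Import boolp reals complex.
Import Order.TTheory GRing.Theory Num.Theory.
Local Open Scope ring_scope.
Local Open Scope complex_scope.
Set Implicit Arguments.
Unset Strict Implicit.
Unset Printing Implicit Defensive.

(** * Central binomial and Catalan series *)

Lemma central_binomialS k :
  (k.+1 * 'C(2 * k.+1, k.+1) = 2 * (2 * k).+1 * 'C(2 * k, k))%N.
Proof.
have -> : (2 * k.+1 = (2 * k).+2)%N by lia.
rewrite -mul_bin_diag /=.
have := mul_bin_diag (2 * k).+1 k; rewrite /= => h.
have : 'C((2 * k).+1, k.+1) = 'C((2 * k).+1, k).
  by rewrite -bin_sub; [congr 'C(_, _); lia | lia].
move: h => /[swap] ->; nia.
Qed.

Lemma sum_central_binomials n :
  (\sum_(k < n.+1) 'C(2 * k, k) * 'C(2 * (n - k), n - k) = 4 ^ n)%N.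
Proof.
pose b k := 'C(2 * k, k).
pose A m := (\sum_(k < m.+1) b k * b (m - k))%N.
have weighted m : (2 * (\sum_(k < m.+1) k * (b k * b (m - k))) = m * A m)%N.
  rewrite mul2n -addnn {2}(reindex_inj rev_ord_inj) -big_split /A big_distrr /=.
  apply: eq_bigr => k _.
  have le_km : (k <= m)%N by rewrite -ltnS.
  by rewrite subSS subKn // [(b (m - k) * _)%N]mulnC -mulnDl subnKC.
rewrite -/(A n); elim: n => [|n IH]; first by rewrite /A big_ord1.
have := weighted n.+1; rewrite big_ord_recl mul0n add0n.
have -> : (\sum_(i < n.+1) bump 0 i * (b (bump 0 i) * b (n.+1 - bump 0 i))
  = 4 * (\sum_(i < n.+1) i * (b i * b (n - i))) + 2 * A n)%N.
  rewrite /A !big_distrr -big_split /=; apply: eq_bigr => i _.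
  rewrite /bump /= add1n subSS mulnA central_binomialS -/(b i).
  by nia.
move=> e; move: (weighted n) e; rewrite IH expnS; set s := (\sum_(i < _) _)%N.
nia.
Qed.

Section CentralBinomialSeries.
Variables (F : numFieldType) (N : nat).

Definition central_poly : {poly F} := \poly_(i < N) 'C(2 * i, i)%:R.

Lemma central_poly_sqr : exists E : {poly F},
  (1 - 4 * 'X) * central_poly ^+ 2 = 1 + 'X^N * E.
Proof.
suff low i : (i < N)%N -> ((1 - 4 * 'X) * central_poly ^+ 2 - 1)`_i = 0.
  exists (drop_poly N ((1 - 4 * 'X) * central_poly ^+ 2 - 1)).
  rewrite -[LHS](subrK 1) [LHS]addrC -{1}(poly_take_drop N (_ - 1)).
  suff -> : take_poly N ((1 - 4 * 'X) * central_poly ^+ 2 - 1) = 0.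
    by rewrite add0r mulrC.
  by apply/polyP => i; rewrite coef_take_poly coef0; case: ifP => // /low.
have sqr m : (m < N)%N -> (central_poly ^+ 2)`_m = 4 ^+ m.
  move=> lt_mN; rewrite expr2 coefM -natrX -sum_central_binomials natr_sum.
  apply: eq_bigr => k _; rewrite !coef_poly natrM.
  have -> : (k < N)%N by apply: leq_trans (ltn_ord k) _.
  by have -> : (m - k < N)%N by apply: leq_ltn_trans (leq_subr _ _) _.
move=> lt_iN; rewrite coefB mulrBl mul1r coefB -mulrA -polyC1 coefC.
rewrite -[4]/(4%:R) -polyC_natr coefCM coefXM sqr //.
case: i lt_iN => [|i] lt_iN /=; first by rewrite mulr0 subr0 subrr.
by rewrite sqr ?(ltnW lt_iN) // -exprS subrr subr0.
Qed.

Definition catalan_poly : {poly F} := 2^-1 *: (1 - (1 - 4 * 'X) * central_poly).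

Lemma catalan_polyE : 2 * catalan_poly = 1 - (1 - 4 * 'X) * central_poly.
Proof.
rewrite -scalerAr mulrC mulr_natr -scaler_nat scalerA mulVf ?scale1r //.
by rewrite pnatr_eq0.
Qed.

Lemma coef_catalan_poly0 : (0 < N)%N -> catalan_poly`_0 = 0.
Proof.
move=> N_gt0; rewrite coefZ coefB coef1 mulrBl mul1r coefB -mulrA.
by rewrite -['X * _]mulrC mulrA coefMX subr0 coef_poly N_gt0 bin0 subrr mulr0.
Qed.

Lemma coef_catalan_polyS k : (k.+1 < N)%N ->
  catalan_poly`_k.+1 = (k.+1%:R)^-1 * 'C(2 * k, k)%:R.
Proof.
move=> ltkN; rewrite coefZ coefB coef1 mulrBl mul1r coefB -mulrA.
rewrite -['X * _]mulrC mulrA coefMX /= -[4]/(4%:R) mulr_natl coefMn.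
rewrite !coef_poly ltkN (ltnW ltkN) sub0r -mulr_natl.
have := congr1 (fun m => m%:R : F) (central_binomialS k).
rewrite /= !natrM -[(2 * k).+1%:R]natr1 natrM -[k.+1%:R]natr1 => e.
have k1 : k%:R + 1 != 0 :> F by rewrite natr1 pnatr_eq0.
have -> : 'C(2 * k.+1, k.+1)%:R =
    2 * (2 * k%:R + 1) * 'C(2 * k, k)%:R / (k%:R + 1) :> F.
  by rewrite -e mulrAC divff ?mul1r.
by field.
Qed.

Lemma catalan_poly_rec m : (m < N)%N ->
  catalan_poly`_m = 'X`_m + (catalan_poly * catalan_poly)`_m.
Proof.
move=> lt_mN; have [E e] := central_poly_sqr.
suff {1}-> : catalan_poly = 'X + catalan_poly * catalan_poly
    + 'X^N * ((4^-1)%:P * ((4 * 'X - 1) * E)).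
  by rewrite !coefD coefXnM lt_mN addr0.
have h4 : (4%:R : {poly F}) * (4^-1)%:P = 1.
  by rewrite -polyC_natr -polyCM divff // pnatr_eq0.
have nz4 : (4%:R : {poly F}) != 0 by rewrite -polyC_natr polyC_eq0 pnatr_eq0.
apply: (mulfI nz4); move: h4; set h := (4^-1)%:P => h4.
set X := 'X; set Z := 'X^N in e *.
transitivity (4 * X + (2 * catalan_poly) * (2 * catalan_poly)
  + (4 * h) * ((4 * X - 1) * (1 + Z * E - 1))); last by ring.
rewrite h4 -e.
transitivity (2 * (2 * catalan_poly)); first by ring.
rewrite catalan_polyE -/X; ring.
Qed.

Variable w : F.

Definition twisted_catalan_poly : {poly F} :=
  \poly_(a < N) (w ^+ a * catalan_poly`_a).

Let B := central_poly.
Let c := catalan_poly.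
Let D := twisted_catalan_poly.

(* The coefficient of degree m is the sum over a + b = m of
   (w^a + w^b) / 2 times the shifted Catalan numbers of indices a and b, for
   exactly one of a, b equal to 1 in the inner case and none in the outer case. *)
Definition inner_weight_poly : {poly F} :=
  'X * (w%:P * (catalan_poly - 'X) + (twisted_catalan_poly - w%:P * 'X)).

Definition outer_weight_poly : {poly F} :=
  (catalan_poly - 'X) * (twisted_catalan_poly - w%:P * 'X).

Definition weight_sum_poly : {poly F} := inner_weight_poly * central_poly.

Let G := inner_weight_poly.
Let s := weight_sum_poly.

Lemma catalan_mul_weight_sum : exists E : {poly F},
  2 * (c * s) = s - G + 'X^N * E.
Proof.
have [E e] := central_poly_sqr; exists (- (G * E)).
have -> : 2 * (c * s) = (2 * c) * (G * B) by rewrite /s /weight_sum_poly -/B -/G; ring.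
rewrite catalan_polyE -/B.
have -> : (1 - (1 - 4 * 'X) * B) * (G * B)
  = G * B - G * ((1 - 4 * 'X) * B ^+ 2) by ring.
rewrite e /s /weight_sum_poly -/B -/G; ring.
Qed.

Lemma weight_sum_poly_rec m : (m < N)%N ->
  s`_m = G`_m + (c * s)`_m + (s * c)`_m.
Proof.
move=> lt_mN; have [E e] := catalan_mul_weight_sum.
have {1}-> : s = G + c * s + s * c + 'X^N * (- E).
  transitivity (G + 2 * (c * s) + 'X^N * (- E)); last by ring.
  by rewrite e; ring.
by rewrite !coefD coefXnM lt_mN addr0.
Qed.

Lemma total_weight_poly : exists E : {poly F},
  2 * (outer_weight_poly + 2 * (c * s)) =
  D - D * B + 6 * ('X * (D * B)) - 4 * ('X * D)
  + w%:P * ('X * (B - 1 - 4 * c + 6 * 'X - 4 * ('X * B))) + 'X^N * E.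
Proof.
have [E e] := central_poly_sqr; have [E' e'] := catalan_mul_weight_sum.
exists (2 * E' - w%:P * 'X * E).
have cB : 2 * (c * B) = B - 1 - 'X^N * E.
  rewrite mulrA catalan_polyE -/B.
  have -> : (1 - (1 - 4 * 'X) * B) * B = B - (1 - 4 * 'X) * B ^+ 2 by ring.
  by rewrite e; ring.
rewrite e' /outer_weight_poly /s /G /weight_sum_poly /inner_weight_poly.
rewrite -/B -/c -/D.
set X := 'X; set W := w%:P; set Z := 'X^N in cB *.
transitivity ((2 * c) * D - 2 * X * D - 4 * W * X * c + 6 * W * X ^+ 2
  + X * W * (2 * (c * B)) - 4 * W * X ^+ 2 * B + 2 * X * D * B
  - 2 * X * D + 2 * (Z * E')).
  ring.
by rewrite catalan_polyE cB -/B -/X; ring.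
Qed.

End CentralBinomialSeries.

Lemma total_weight_coef (F : numFieldType) (w : F) n
    (cat := fun k => k.+1%:R^-1 * 'C(2 * k, k)%:R : F) : (4 <= n)%N ->
  (outer_weight_poly n w + 2 * (catalan_poly F n * weight_sum_poly n w))`_(n - 1)
    / cat (n - 2)%N =
    - ((n%:R - 1) * (2 * w ^+ (n - 2)%N + 3 * w)) / (2 * (2 * n%:R - 5))
    + 3 * w / cat (n - 2)%N
      * \sum_(0 <= j < (n - 3).+1)
          w ^+ j * cat j * ('C(2 * n - 6 - 2 * j, n - 3 - j))%:R
    - w / (2 * cat (n - 2)%N)
      * \sum_(0 <= j < (n - 3).+1)
          w ^+ j * cat j * ('C(2 * n - 4 - 2 * j, n - 2 - j))%:R.
Proof.
case: n => [|[|[|[|m]]]] // _; set n := m.+4.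
rewrite (_ : n - 1 = m.+3)%N // (_ : n - 2 = m.+2)%N // (_ : n - 3 = m.+1)%N //.
have [E e] := total_weight_poly n w.
have D0 : (twisted_catalan_poly n w)`_0 = 0.
  by rewrite coef_poly coef_catalan_poly0 // mulr0.
have DS k : (k.+1 < n)%N -> (twisted_catalan_poly n w)`_k.+1 = w ^+ k.+1 * cat k.
  by move=> lt_kn; rewrite coef_poly lt_kn coef_catalan_polyS.
have DB k : (k.+1 < n)%N -> (twisted_catalan_poly n w * central_poly F n)`_k.+1 =
    w * \sum_(0 <= j < k.+1) w ^+ j * cat j * 'C(2 * (k - j), k - j)%:R.
  move=> lt_kn; rewrite coefM big_ord_recl D0 mul0r add0r big_mkord big_distrr.
  apply: eq_bigr => j _; rewrite /= /bump add1n subSS DS; last first.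
    by apply: leq_ltn_trans lt_kn; rewrite ltnS -ltnS.
  rewrite coef_poly (leq_ltn_trans (leq_subr _ _)) ?(ltnW lt_kn) //.
  by rewrite exprS !mulrA.
have coefn k (p : {poly F}) i : (k%:R * p)`_i = k%:R * p`_i.
  by rewrite mulr_natl coefMn mulr_natl.
have := congr1 (fun p : {poly F} => p`_m.+3) e.
set S := outer_weight_poly n w + _.
rewrite !(coefD, coefB, coefN, coefn, coefCM, coefXM, coefXnM) /= coef1 coefX /=.
rewrite ltnSn !DB // !DS //= coef_catalan_polyS // -/(cat _).
rewrite big_nat_recr //= subnn muln0 bin0 mulr1 !coef_poly.
have -> : (m.+2 < n)%N by []. have -> : (m.+1 < n)%N by rewrite /n ltnW.
have bE k : 'C(2 * k, k)%:R = k.+1%:R * cat k.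
  by rewrite mulrA divff ?mul1r // pnatr_eq0.
rewrite !bE.
have cat_rec : m.+3%:R * cat m.+2 = 2 * (2 * m.+1%:R + 1) * cat m.+1.
  have := congr1 (fun k => k%:R : F) (central_binomialS m.+1).
  rewrite /= !natrM !bE -[(2 * m.+1).+1%:R]natr1 natrM => h.
  have nz : m.+2%:R != 0 :> F by rewrite pnatr_eq0.
  by apply: (mulfI nz); rewrite h; ring.
have binE a k j : (j <= k)%N -> (2 * n - a = 2 * k)%N ->
    'C(2 * n - a - 2 * j, k - j) = 'C(2 * (k - j), k - j).
  by move=> le_jk ->; rewrite -mulnBr.
set s1 := (\sum_(0 <= j < m.+2) _ * 'C(2 * (m.+1 - j), _)%:R).
set s2 := (\sum_(0 <= j < m.+2) _ * 'C(2 * (m.+2 - j), _)%:R).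
have -> : \sum_(0 <= j < m.+2) w ^+ j * cat j * 'C(2 * n - 6 - 2 * j, m.+1 - j)%:R = s1.
  by apply: eq_big_nat => j /andP[_ lt_j]; rewrite binE // /n; lia.
have -> : \sum_(0 <= j < m.+2) w ^+ j * cat j * 'C(2 * n - 4 - 2 * j, m.+2 - j)%:R = s2.
  by apply: eq_big_nat => j /andP[_ lt_j]; rewrite binE // /n; lia.
set T := (_ + 2 * _) => eT.
have catNz : cat m.+2 != 0.
  by rewrite mulf_neq0 ?invr_eq0 ?pnatr_eq0 // -lt0n bin_gt0; lia.
have mS k : (m + k)%:R = m%:R + k%:R :> F by rewrite natrD.
have nz : 2 * m%:R + 3 != 0 :> F by rewrite -natrM -natrD pnatr_eq0 addn3.
have catE : cat m.+1 = (m%:R + 3) * cat m.+2 / (2 * (2 * m%:R + 3)).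
  have {}cat_rec : (m%:R + 3) * cat m.+2 = 2 * (2 * m%:R + 3) * cat m.+1.
    by move: cat_rec; rewrite -(addn3 m) -(addn1 m) !mS => ->; ring.
  by rewrite cat_rec; field.
have -> : T = 2^-1 * (2 * T) by field.
rewrite eT catE.
rewrite -[n]/(m.+4) [w ^+ m.+3]exprS.
move: (cat m.+2) (w ^+ m.+2) catNz => x y x0.
rewrite -(addn4 m) -(addn3 m) -(addn2 m) !mS.
by field; rewrite x0 /= (_ : 2 * (m%:R + 4) - 5 = 2 * m%:R + 3) //; ring.
Qed.

(** * Full dissections of a range of vertices *)

Section Dissections.
Variable n : nat.
Implicit Types (i j k a b : 'I_n) (d e : 'I_n * 'I_n) (T A B : {set 'I_n * 'I_n}).

Definition chord T a b := (b == a.+1 :> nat) || ((a, b) \in T).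

Definition interleave d e := [&& d.1 < e.1, e.1 < d.2 & d.2 < e.2]%N.

Definition noncrossing T := [forall d in T, forall e in T, ~~ interleave d e].

Definition within i j : {set 'I_n * 'I_n} :=
  [set d : 'I_n * 'I_n | [&& i <= d.1, d.1.+1 < d.2 & d.2 <= j]%N].

(* By [card_noncrossing], these are the noncrossing sets of maximal size. *)
Definition full i j : {set {set 'I_n * 'I_n}} :=
  [set T : {set 'I_n * 'I_n} |
    [&& noncrossing T, T \subset within i j & #|T| == (j - i).-1]].

Definition glue i j A B := (i, j) |: (A :|: B).

Lemma noncrossingP T : reflect
  (forall a b a' b', (a, b) \in T -> (a', b') \in T -> ~~ [&& a < a', a' < b & b < b']%N)
  (noncrossing T).
Proof.
apply: (iffP forall_inP) => [nc a b a' b' ab a'b' | nc [a b] ab].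
  by have /forall_inP/(_ _ a'b') := nc _ ab; rewrite /interleave /=; lia.
apply/forall_inP => -[a' b'] a'b'.
by have := nc _ _ _ _ ab a'b'; rewrite /interleave /=; lia.
Qed.

Lemma noncrossingS A T : A \subset T -> noncrossing T -> noncrossing A.
Proof.
move=> /subsetP sAT /noncrossingP nc; apply/noncrossingP => a b a' b'.
by move=> /sAT + /sAT; apply: nc.
Qed.

Lemma mem_within i j a b :
  ((a, b) \in within i j) = [&& i <= a, a.+1 < b & b <= j]%N.
Proof. by rewrite inE. Qed.

Lemma withinP i j T a b : T \subset within i j -> (a, b) \in T ->
  [&& i <= a, a.+1 < b & b <= j]%N.
Proof. by move=> /subsetP sT /sT; rewrite mem_within. Qed.

Lemma card_cut i k j T : (i < k < j)%N ->
    T \subset [set (i, j)] :|: (within i k :|: within k j) ->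
  #|T| = (((i, j) \in T) + (#|T :&: within i k| + #|T :&: within k j|))%N.
Proof.
move=> ikj sT.
rewrite (cardsD1 (i, j)); congr (_ + _)%N.
have -> : T :\ (i, j) = (T :&: within i k) :|: (T :&: within k j).
  apply/setP => -[a b]; rewrite !(inE, mem_within) xpair_eqE.
  case: (boolP (_ \in T)) => [/(subsetP sT)|]; last by rewrite !andbF.
  by rewrite !(inE, mem_within) xpair_eqE -!val_eqE /=; lia.
have I0 : (T :&: within i k) :&: (T :&: within k j) = set0.
  by apply/setP => -[a b]; rewrite !(inE, mem_within) /=; case: (_ \in T); lia.
by rewrite cardsU I0 cards0 subn0.
Qed.

Lemma exists_cut i j T : (i.+1 < j)%N -> noncrossing T -> T \subset within i j ->
  exists2 k : 'I_n, (i < k < j)%N & T \subset [set (i, j)] :|: (within i k :|: within k j).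
Proof.
move=> lt_ij /noncrossingP nc sT.
have i1_lt : (i.+1 < n)%N by apply: ltn_trans (ltn_ord j).
pose P (k : 'I_n) := (i < k < j)%N && chord T i k.
have P0 : P (Ordinal i1_lt) by rewrite /P /chord /= eqxx; lia.
case: (arg_maxnP (@nat_of_ord n) P0) => k /andP[ikj ik] kmax; exists k => //.
apply/subsetP => -[a b] abT; have := withinP sT abT.
rewrite !(inE, mem_within) xpair_eqE -!val_eqE /=.
case: (ltngtP a i) => [||/ord_inj a_i]; first by lia.
  move=> lt_ia; case/orP: ik => [|ik]; first lia.
  by have := nc _ _ _ _ ik abT; lia.
subst a; move=> h; have := kmax b; rewrite /P /chord abT orbT andbT; lia.
Qed.

Lemma card_noncrossing i j T : (i < j)%N -> noncrossing T ->
  T \subset within i j -> (#|T| <= (j - i).-1)%N.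
Proof.
have [m le_m] := ubnP (j - i)%N.
elim: m i j T le_m => // m IH i j T; rewrite ltnS => le_m lt_ij nc sT.
have [/exists_cut|le_ji] := ltnP i.+1 j.
  move=> /(_ _ nc sT) [k ikj /(card_cut ikj)->].
  have lT k1 k2 : (k1 < k2)%N -> (k2 - k1 < m)%N ->
      (#|T :&: within k1 k2| <= (k2 - k1).-1)%N.
    move=> lt12 ltm; apply: IH => //; last exact: subsetIr.
    exact: noncrossingS (subsetIl _ _) nc.
  have := lT i k; have := lT k j; case: (_ \in T); lia.
suff -> : T = set0 by rewrite cards0.
by apply/setP => -[a b]; rewrite inE; apply/negP => /(withinP sT); lia.
Qed.

Lemma card_sub_within i j T : (i < j)%N -> noncrossing T ->
  (#|T :&: within i j| <= (j - i).-1)%N.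
Proof.
move=> lt_ij nc; apply: card_noncrossing => //; last exact: subsetIr.
exact: noncrossingS (subsetIl _ _) nc.
Qed.

Lemma fullP i j T :
  reflect [/\ noncrossing T, T \subset within i j & #|T| = (j - i).-1]
          (T \in full i j).
Proof.
by rewrite inE; apply: (iffP and3P) => -[? ? /eqP ?]; split=> //; apply/eqP.
Qed.

Lemma sub_within_full i j T : noncrossing T ->
  #|T :&: within i j| = (j - i).-1 -> T :&: within i j \in full i j.
Proof.
move=> nc cT; apply/fullP; split=> //; last exact: subsetIr.
exact: noncrossingS (subsetIl _ _) nc.
Qed.

Lemma full_cut i k j T : (i < k < j)%N ->
    T \subset [set (i, j)] :|: (within i k :|: within k j) ->
    T \in full i j ->
  [/\ (i, j) \in T, T :&: within i k \in full i k & T :&: within k j \in full k j].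
Proof.
move=> ikj sT /fullP[nc _ cT].
have := card_cut ikj sT; rewrite cT.
have := @card_sub_within i k T; have := @card_sub_within k j T.
have [ijT|_] := boolP ((i, j) \in T); last by lia.
move=> h1 h2 e; split=> //; apply: sub_within_full => //; lia.
Qed.

Lemma full_base i j T : (i.+1 < j)%N -> T \in full i j -> (i, j) \in T.
Proof.
move=> lt_ij fT; have /fullP[nc sT _] := fT.
by have [k ikj /(full_cut ikj)/(_ fT)[]] := exists_cut lt_ij nc sT.
Qed.

Lemma full_chord i j T : (i < j)%N -> T \in full i j -> chord T i j.
Proof.
move=> lt_ij fT; rewrite /chord; case: (ltnP i.+1 j) => [/full_base->|]; rewrite ?orbT //.
lia.
Qed.

Lemma full_side i j T : (j = i.+1 :> nat) -> (T \in full i j) = (T == set0).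
Proof.
move=> e; apply/fullP/eqP => [[_ _]|->].
  by rewrite e subSnn => /eqP; rewrite cards_eq0 => /eqP.
rewrite sub0set cards0 e subSnn; split=> //.
by apply/noncrossingP => a b a' b'; rewrite inE.
Qed.

Lemma chordS A T a b : A \subset T -> chord A a b -> chord T a b.
Proof. by move=> /subsetP sAT /orP[|/sAT]; rewrite /chord => ->; rewrite ?orbT. Qed.

Lemma chord_within i j T a b : (i <= a)%N -> (a < b)%N -> (b <= j)%N ->
  chord (T :&: within i j) a b = chord T a b.
Proof.
move=> ia ab bj; rewrite /chord inE mem_within.
have [//|ne] := altP eqP.
have -> : [&& i <= a, a.+1 < b & b <= j]%N by lia.
by rewrite andbT.
Qed.

Definition apex i j T k := [&& (i < k < j)%N, chord T i k & chord T k j].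

Lemma apex_cut i j T k : noncrossing T -> T \subset within i j -> apex i j T k ->
  T \subset [set (i, j)] :|: (within i k :|: within k j).
Proof.
move=> /noncrossingP nc sT /and3P[ikj ik kj].
apply/subsetP => -[a b] abT; have := withinP sT abT.
rewrite !(inE, mem_within) xpair_eqE -!val_eqE /= => h.
have h1 : ~~ [&& i < a, a < k & k < b]%N.
  by case/orP: ik => [|/nc/(_ abT)]; lia.
have h2 : ~~ [&& a < k, k < b & b < j]%N.
  by case/orP: kj => [|/(nc _ _ _ _ abT)]; lia.
lia.
Qed.

Lemma apex_uniq i j T k k' : noncrossing T -> apex i j T k -> apex i j T k' -> k = k'.
Proof.
move=> /noncrossingP nc /and3P[ikj ik kj] /and3P[ikj' ik' kj']; apply: ord_inj.
case: (ltngtP k k') => // lt_kk'.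
  case/orP: ik' => [|ik']; first lia.
  by case/orP: kj => [|/(nc _ _ _ _ ik')]; lia.
case/orP: ik => [|ik]; first lia.
by case/orP: kj' => [|/(nc _ _ _ _ ik)]; lia.
Qed.

Lemma glue_within i j T k : T \subset [set (i, j)] :|: (within i k :|: within k j) ->
  (i, j) \in T -> glue i j (T :&: within i k) (T :&: within k j) = T.
Proof.
move=> sT ijT; apply/setP => d; rewrite /glue !in_setU !in_setI in_set1 -andb_orr.
have [->|/= ne] := eqVneq d; first by rewrite ijT.
have [/(subsetP sT)|//] := boolP (d \in T).
by rewrite !in_setU in_set1 (negbTE ne).
Qed.

Lemma exists_apex i j T : (i.+1 < j)%N -> T \in full i j -> exists k, apex i j T k.
Proof.
move=> lt_ij fT; have /fullP[nc sT _] := fT.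
have [k ikj /(full_cut ikj)/(_ fT)[_ f1 f2]] := exists_cut lt_ij nc sT.
exists k; rewrite /apex ikj.
rewrite (chordS (subsetIl T (within i k)) (full_chord _ f1)); last by case/andP: ikj.
by rewrite (chordS (subsetIl T (within k j)) (full_chord _ f2)) //; case/andP: ikj.
Qed.

Section Glue.
Variables (i k j : 'I_n) (A B : {set 'I_n * 'I_n}).
Hypotheses (ikj : (i < k < j)%N) (fA : A \in full i k) (fB : B \in full k j).

Let sA : A \subset within i k. Proof. by case/fullP: fA. Qed.
Let sB : B \subset within k j. Proof. by case/fullP: fB. Qed.

Lemma glue_setI_left : glue i j A B :&: within i k = A.
Proof.
apply/setP => -[a b]; rewrite !(inE, mem_within) xpair_eqE -!val_eqE /=.
have [/(withinP sA)|_] := boolP (_ \in A); first by rewrite orbT /=; lia.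
by have [/(withinP sB)|_] := boolP (_ \in B); lia.
Qed.

Lemma glue_setI_right : glue i j A B :&: within k j = B.
Proof.
apply/setP => -[a b]; rewrite !(inE, mem_within) xpair_eqE -!val_eqE /=.
have [/(withinP sB)|_] := boolP (_ \in B); first by rewrite !orbT /=; lia.
by have [/(withinP sA)|_] := boolP (_ \in A); lia.
Qed.

Lemma glue_cut :
  glue i j A B \subset [set (i, j)] :|: (within i k :|: within k j).
Proof. by rewrite /glue setUS // setUSS. Qed.

Lemma apex_glue : apex i j (glue i j A B) k.
Proof.
case/andP: (ikj) => ik kj; rewrite /apex ikj.
rewrite (chordS _ (full_chord ik fA)) ?(chordS _ (full_chord kj fB)) //.
  by apply/subsetP => d dB; rewrite !inE dB !orbT.
by apply/subsetP => d dA; rewrite !inE dA !orbT.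
Qed.

Lemma glue_full : glue i j A B \in full i j.
Proof.
have /fullP[/noncrossingP ncA _ cA] := fA.
have /fullP[/noncrossingP ncB _ cB] := fB.
apply/fullP; split.
- apply/noncrossingP => a b a' b'; rewrite !inE !xpair_eqE -!val_eqE /=.
  case/or3P => [ab|abA|abB] /or3P[ab'|abA'|abB'].
  + lia.
  + by have := withinP sA abA'; lia.
  + by have := withinP sB abB'; lia.
  + by have := withinP sA abA; lia.
  + exact: ncA abA abA'.
  + by have := withinP sA abA; have := withinP sB abB'; lia.
  + by have := withinP sB abB; lia.
  + by have := withinP sB abB; have := withinP sA abA'; lia.
  + exact: ncB abB abB'.
- apply/subsetP => -[a b] /(subsetP glue_cut).
  by rewrite !(inE, mem_within) xpair_eqE -!val_eqE /=; lia.
rewrite (card_cut ikj glue_cut) glue_setI_left glue_setI_right cA cB.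
by rewrite !inE eqxx /=; lia.
Qed.
End Glue.

Lemma full_split i j T : (i.+1 < j)%N -> T \in full i j ->
  exists k A B,
    [/\ (i < k < j)%N, A \in full i k, B \in full k j & T = glue i j A B].
Proof.
move=> lt_ij fT; have [k ak] := exists_apex lt_ij fT.
have /fullP[nc sT _] := fT; have cut := apex_cut nc sT ak.
have ikj : (i < k < j)%N by case/and3P: ak.
have [ijT f1 f2] := full_cut ikj cut fT.
by exists k, (T :&: within i k), (T :&: within k j); rewrite glue_within.
Qed.

Lemma sum_full (V : nmodType) i j (X : {set 'I_n * 'I_n} -> V) : (i.+1 < j)%N ->
  \sum_(T in full i j) X T =
  \sum_(k : 'I_n | (i < k < j)%N)
    \sum_(A in full i k) \sum_(B in full k j) X (glue i j A B).
Proof.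
move=> lt_ij.
transitivity (\sum_(T in full i j) \sum_(k : 'I_n | apex i j T k) X T).
  apply: eq_bigr => T fT; have [k ak] := exists_apex lt_ij fT.
  have /fullP[nc _ _] := fT.
  rewrite (big_pred1 k) // => k'; apply/idP/eqP => [ak'|->//].
  exact: apex_uniq nc ak' ak.
rewrite (exchange_big_dep (fun k : 'I_n => (i < k < j)%N)) /=; last first.
  by move=> T k _ /and3P[].
apply: eq_bigr => k ikj.
rewrite pair_big_dep /=.
rewrite (reindex_onto (fun p => glue i j p.1 p.2)
  (fun T => (T :&: within i k, T :&: within k j))) /=; last first.
  move=> T /andP[fT ak]; have /fullP[nc sT _] := fT.
  have cut := apex_cut nc sT ak; have [ijT _ _] := full_cut ikj cut fT.
  exact: glue_within.
apply: eq_bigl => -[A B] /=; apply/andP/andP => [[/andP[fT ak] /eqP[eA eB]]|[fA fB]].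
  have /fullP[nc sT _] := fT.
  by have := full_cut ikj (apex_cut nc sT ak) fT; rewrite eA eB => -[].
by rewrite (glue_full ikj) // (apex_glue ikj) // glue_setI_left // glue_setI_right.
Qed.

Definition tri T : {set 'I_n * 'I_n * 'I_n} :=
  [set t : 'I_n * 'I_n * 'I_n | let: (l, m, r) := t in
    [&& l < m, m < r, chord T l m, chord T m r & chord T l r]%N].

Lemma tri0 : tri set0 = set0.
Proof.
by apply/setP => -[[l m] r]; rewrite !inE /chord !inE !orbF; lia.
Qed.

Lemma tri_within i j T l m r : T \subset within i j -> (l, m, r) \in tri T ->
  [&& i <= l, l < m, m < r & r <= j]%N.
Proof.
move=> sT; rewrite inE => /and5P[lm mr _ _ /orP[|/(withinP sT)]]; lia.
Qed.

Lemma tri_glue i k j A B : (i < k < j)%N -> A \in full i k -> B \in full k j ->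
  tri (glue i j A B) = (i, k, j) |: (tri A :|: tri B).
Proof.
move=> ikj fA fB; set T := glue i j A B.
have /fullP[nc _ _] := glue_full ikj fA fB.
have ak := apex_glue ikj fA fB.
have TA := glue_setI_left ikj fA fB; have TB := glue_setI_right ikj fA fB.
have /fullP[_ sA _] := fA; have /fullP[_ sB _] := fB.
apply/setP => -[[l m] r]; rewrite !in_setU in_set1.
apply/idP/idP; last first.
  case/or3P => [/eqP[-> -> ->]|lmr|lmr].
  - case/and3P: ak => /andP[ik kj] c1 c2; rewrite inE ik kj c1 c2 /=.
    by rewrite /chord /glue !inE eqxx orbT.
  - have := tri_within sA lmr; move: lmr; rewrite !inE -TA => + h.
    by rewrite !chord_within //; lia.
  have := tri_within sB lmr; move: lmr; rewrite !inE -TB => + h.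
  by rewrite !chord_within //; lia.
move=> lmr; have := lmr; rewrite inE => /and5P[lm mr clm cmr].
have side_case a b : (a <= l)%N -> (r <= b)%N -> (l, m, r) \in tri (T :&: within a b).
  move=> al rb; move: lmr; rewrite !inE !chord_within //; lia.
case/orP => [|lrT]; first lia.
have : [|| (l, r) == (i, j), (l, r) \in A | (l, r) \in B].
  by move: lrT; rewrite /T /glue !inE.
case/or3P => [/eqP[li rj]|/(withinP sA) h|/(withinP sB) h].
- subst l r; have am : apex i j T m by rewrite /apex lm mr clm.
  by rewrite (apex_uniq nc am ak) eqxx.
- by rewrite -[A]TA side_case ?orbT //; lia.
by rewrite -[B]TB side_case ?orbT //; lia.
Qed.

Lemma sum_tri_glue (V : nmodType) (g : 'I_n * 'I_n * 'I_n -> V) i k j A B :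
    (i < k < j)%N -> A \in full i k -> B \in full k j ->
  \sum_(t in tri (glue i j A B)) g t =
    g (i, k, j) + (\sum_(t in tri A) g t + \sum_(t in tri B) g t).
Proof.
move=> ikj fA fB; rewrite (tri_glue ikj) //.
have /fullP[_ sA _] := fA; have /fullP[_ sB _] := fB.
have dis : [disjoint tri A & tri B].
  rewrite -setI_eq0; apply/eqP/setP => -[[l m] r]; rewrite in_set0 in_setI.
  by apply/negP => /andP[/(tri_within sA) + /(tri_within sB)]; lia.
rewrite big_setU1 /=.
  by rewrite -bigU //; congr (_ + _); apply: eq_bigl => t; rewrite !inE.
rewrite in_setU; apply/negP => /orP[/(tri_within sA)|/(tri_within sB)]; lia.
Qed.

Lemma card_tri i j T : (i < j)%N -> T \in full i j -> #|tri T| = (j - i).-1.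
Proof.
have [m le_m] := ubnP (j - i)%N.
elim: m i j T le_m => // m IH i j T; rewrite ltnS => le_m lt_ij fT.
have [lt|le] := ltnP i.+1 j; last first.
  have e : (j = i.+1 :> nat) by lia.
  by move: fT; rewrite full_side // => /eqP->; rewrite tri0 cards0 e subSnn.
have [k [A [B [ikj fA fB ->]]]] := full_split lt fT.
have := sum_tri_glue (fun=> 1%N) ikj fA fB; rewrite !sum1_card => ->.
by rewrite (IH _ _ _ _ _ fA) ?(IH _ _ _ _ _ fB) // -?natrDE; lia.
Qed.

End Dissections.

(** * Total weight of the full dissections *)

Lemma coefM_between (R : nzRingType) (p q : {poly R}) n (i j : 'I_n) :
    (i < j)%N -> p`_0 = 0 -> q`_0 = 0 ->
  (p * q)`_(j - i) = \sum_(k : 'I_n | (i < k < j)%N) p`_(k - i) * q`_(j - k).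
Proof.
move=> lt_ij p0 q0.
have [m def_m] : exists m, (j - i = m.+1)%N by exists (j - i).-1; lia.
transitivity (\sum_(i.+1 <= k < j) p`_(k - i) * q`_(j - k)).
  rewrite def_m coefM big_ord_recl big_ord_recr /= /bump /= add1n subnn p0 q0.
  rewrite mul0r mulr0 add0r addr0 -{1}[i.+1]add0n big_addn.
  have -> : (j - i.+1 = m)%N by lia.
  rewrite big_mkord; apply: eq_bigr => a _; have := ltn_ord a => lt_am.
  by congr (p`__ * q`__); rewrite ?add1n; lia.
rewrite (big_nat_widenl _ 0) // (big_nat_widen _ _ n) ?(ltnW (ltn_ord j)) //.
by rewrite big_mkord.
Qed.

Section Counting.
Variables (F : numFieldType) (n : nat).
Hypothesis n_gt1 : (1 < n)%N.
Implicit Types (i j k : 'I_n).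

Let c := catalan_poly F n.

Let c0 : c`_0 = 0. Proof. by rewrite coef_catalan_poly0 // ltnW. Qed.

Let c1 : c`_1 = 1.
Proof. by rewrite coef_catalan_polyS // bin0 invr1 mulr1. Qed.

Lemma card_full i j : (i < j)%N -> #|full i j|%:R = c`_(j - i).
Proof.
have [m le_m] := ubnP (j - i)%N.
elim: m i j le_m => // m IH i j; rewrite ltnS => le_m lt_ij.
have [lt|le] := ltnP i.+1 j; last first.
  have e : (j = i.+1 :> nat) by lia.
  have -> : full i j = [set set0].
    by apply/setP => T; rewrite full_side // inE.
  by rewrite cards1 e subSnn c1.
rewrite catalan_poly_rec; last by apply: leq_ltn_trans (leq_subr _ _) _.
rewrite coefX coefM_between // (_ : (j - i == 1)%N = false) ?add0r; last lia.
rewrite -sum1_card natr_sum sum_full //; apply: eq_bigr => k /andP[ik kj].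
rewrite -!IH //; try lia.
under eq_bigr do rewrite -natr_sum sum1_card.
by rewrite sumr_const [RHS]mulr_natl.
Qed.

Variable w : F.

Definition gap_weight a b : F :=
  if ((a == 1%N) + (b == 1%N) == 1)%N then 2^-1 * (w ^+ a + w ^+ b) else 0.

Let D := twisted_catalan_poly n w.
Let s := weight_sum_poly n w.

Let s0 : s`_0 = 0.
Proof. by rewrite /s /weight_sum_poly /inner_weight_poly -mulrA coefXM. Qed.

Let Dw : D - w%:P * 'X = \poly_(a < n) (w ^+ a * (c - 'X)`_a).
Proof.
apply/polyP => a; rewrite coefB coefCM coefX !coef_poly coefB coefX.
case: ltnP => [_|le_na]; last by rewrite gtn_eqF ?mulr0 ?subr0 // (leq_trans n_gt1).
by case: eqVneq => [->|_] /=; ring.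
Qed.

Let halfD (p : {poly F}) : 2^-1 *: (p + p) = p.
Proof. by rewrite -mulr2n -scaler_nat scalerA mulVf ?scale1r // pnatr_eq0. Qed.

Let coef_cX a : (c - 'X)`_a = if (a == 1)%N then 0 else c`_a.
Proof. by rewrite coefB coefX; case: eqVneq => [->|_]; rewrite ?c1 ?subrr ?subr0. Qed.

Lemma sum_full_step (g : 'I_n * 'I_n * 'I_n -> F) i j
    (W := fun i j => \sum_(T in full i j) \sum_(t in tri T) g t) :
    (i.+1 < j)%N ->
  W i j = \sum_(k : 'I_n | (i < k < j)%N)
    (g (i, k, j) * (c`_(k - i) * c`_(j - k))
     + (W i k * c`_(j - k) + c`_(k - i) * W k j)).
Proof.
move=> lt_ij; rewrite {1}/W sum_full //; apply: eq_bigr => k ikj.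
have [ik kj] := andP ikj.
under eq_bigr => A fA do under eq_bigr => B fB do rewrite (sum_tri_glue _ ikj) //.
rewrite -!card_full //.
under eq_bigr => A fA do rewrite !big_split /= !sumr_const.
rewrite !big_split /= !sumr_const !sumrMnl -/(W i k) -/(W k j).
by rewrite mulrA !mulr_natr mulr_natl mulrnAC.
Qed.

Lemma sum_gap_weight i j : (i < j)%N ->
  \sum_(k : 'I_n | (i < k < j)%N)
     gap_weight (k - i)%N (j - k)%N * (c`_(k - i) * c`_(j - k)) =
  (inner_weight_poly n w)`_(j - i).
Proof.
move=> lt_ij; pose Q := w%:P * (c - 'X) + (D - w%:P * 'X).
have Q0 : Q`_0 = 0.
  by rewrite /Q coefD coefCM Dw coef_poly coefB coefX c0 subrr !mulr0 if_same addr0.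
have X0 : ('X : {poly F})`_0 = 0 by rewrite coefX.
have -> : inner_weight_poly n w = 2^-1 *: ('X * Q + Q * 'X).
  by rewrite [Q * 'X]mulrC halfD.
rewrite coefZ coefD !coefM_between // -big_split big_distrr /=.
apply: eq_bigr => k /andP[ik kj].
have lt_ki : (k - i < n)%N by apply: leq_ltn_trans (leq_subr _ _) _.
have lt_jk : (j - k < n)%N by apply: leq_ltn_trans (leq_subr _ _) _.
rewrite /Q Dw !(coefD (w%:P * _)) !coefCM !coef_poly lt_ki lt_jk.
rewrite !coef_cX !coefX /gap_weight.
by case: (eqVneq (k - i)%N) => [->|_]; case: (eqVneq (j - k)%N) => [->|_] /=;
   rewrite ?c1 ?expr1; ring.
Qed.

Lemma sum_full_inner (g : 'I_n * 'I_n * 'I_n -> F) :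
    (forall i k j, (i < k < j)%N -> (0 < i)%N || (j < n.-1)%N ->
       g (i, k, j) = gap_weight (k - i)%N (j - k)%N) ->
  forall i j, (i < j)%N -> (0 < i)%N || (j < n.-1)%N ->
  \sum_(T in full i j) \sum_(t in tri T) g t = s`_(j - i).
Proof.
move=> g_gap i j; have [m le_m] := ubnP (j - i)%N.
elim: m i j le_m => // m IH i j; rewrite ltnS => le_m lt_ij ij_in.
have [lt|le] := ltnP i.+1 j; last first.
  have e : (j = i.+1 :> nat) by lia.
  rewrite (big_pred1 set0) => [|T]; last by rewrite full_side.
  rewrite tri0 big_set0 e subSnn /s /weight_sum_poly /inner_weight_poly.
  by rewrite -mulrA coefXM /= coef0M coefD coefCM Dw coef_poly coefB c0 coefX subrr
    !mulr0 if_same addr0 mul0r.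
rewrite sum_full_step // weight_sum_poly_rec; last first.
  by apply: leq_ltn_trans (leq_subr _ _) _.
rewrite -sum_gap_weight // !coefM_between // -!big_split.
apply: eq_bigr => k /andP[ik kj] /=.
rewrite g_gap ?ik // !IH //; try lia.
by rewrite -addrA [c`_ _ * _ + _]addrC.
Qed.

Lemma sum_full_outer (g : 'I_n * 'I_n * 'I_n -> F) i j :
    (forall i k j, (i < k < j)%N -> (0 < i)%N || (j < n.-1)%N ->
       g (i, k, j) = gap_weight (k - i)%N (j - k)%N) ->
    i = 0%N :> nat -> j = n.-1 :> nat -> (2 < n)%N ->
    (forall k, (i < k < j)%N -> g (i, k, j) =
       if (k - i == 1)%N || (j - k == 1)%N then 0
       else 2^-1 * (w ^+ (k - i) + w ^+ (j - k))) ->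
  \sum_(T in full i j) \sum_(t in tri T) g t =
  (outer_weight_poly n w + 2 * (c * s))`_(n - 1).
Proof.
move=> g_gap i0 jn n_gt2 g_out.
have lt : (i.+1 < j)%N by lia.
have -> : (n - 1 = j - i)%N by lia.
have DX0 : (D - w%:P * 'X)`_0 = 0.
  by rewrite Dw coef_poly coefB c0 coefX subrr mulr0 if_same.
have cX0 : (c - 'X)`_0 = 0 by rewrite coef_cX c0.
pose P := c - 'X; pose Q := D - w%:P * 'X.
have -> : outer_weight_poly n w = 2^-1 *: (P * Q + Q * P).
  by rewrite [Q * P]mulrC halfD.
have -> : 2 * (c * s) = c * s + s * c by ring.
rewrite sum_full_step // !(coefD, coefZ) !coefM_between //; try lia.
rewrite -!big_split big_distrr -big_split; apply: eq_bigr => k /andP[ik kj] /=.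
have lt_ki : (k - i < n)%N by apply: leq_ltn_trans (leq_subr _ _) _.
have lt_jk : (j - k < n)%N by apply: leq_ltn_trans (leq_subr _ _) _.
rewrite g_out ?ik // !(sum_full_inner g_gap) //; try lia.
rewrite /P /Q Dw !coef_poly lt_ki lt_jk !coef_cX.
by case: (eqVneq (k - i)%N) => [->|_]; case: (eqVneq (j - k)%N) => [->|_] /=;
   rewrite ?c1 ?expr1; field.
Qed.

End Counting.

(** * Convex geometry *)

Section Geometry.
Variable R : realType.
Implicit Types a b c d p q : R * R.

Lemma orient_rot a b c : orient a b c = orient b c a.
Proof. by rewrite /orient; ring. Qed.

Lemma orient_swap a b c : orient a b c = - orient b a c.
Proof. by rewrite /orient; ring. Qed.

Lemma orient_refl a b : orient a b a = 0 /\ orient a b b = 0.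
Proof. by rewrite /orient; split; ring. Qed.

Lemma orient_convex a b c d p (t : R) :
    p.1 = (1 - t) * c.1 + t * d.1 -> p.2 = (1 - t) * c.2 + t * d.2 ->
  orient a b p = (1 - t) * orient a b c + t * orient a b d.
Proof. by rewrite /orient => -> ->; ring. Qed.

Lemma orient_barycentric a b c d e p :
  orient a b c * orient d e p =
    orient b c p * orient d e a + orient c a p * orient d e b
    + orient a b p * orient d e c.
Proof. by rewrite /orient; ring. Qed.

Lemma open_segments_meet a b c d :
    orient c d a < 0 -> 0 < orient c d b -> 0 < orient a b c -> orient a b d < 0 ->
  exists p, in_open_segment a b p /\ in_open_segment c d p.
Proof.
move=> cda cdb abc abd.
pose x := orient c d b - orient c d a.
have x_gt0 : 0 < x by rewrite subr_gt0 (lt_trans cda).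
have xE : x = orient a b c - orient a b d by rewrite /x /orient; ring.
have x_neq0 := lt0r_neq0 x_gt0.
exists ((1 - - orient c d a / x) * a.1 + - orient c d a / x * b.1,
        (1 - - orient c d a / x) * a.2 + - orient c d a / x * b.2).
split.
  exists (- orient c d a / x); split=> //.
  by rewrite divr_gt0 ?oppr_gt0 //= ltr_pdivrMr // mul1r /x; lra.
exists (orient a b c / x); split.
- by rewrite divr_gt0 //= ltr_pdivrMr // mul1r xE; lra.
- apply: (mulfI x_neq0); rewrite /= /x /orient; field.
  by move: x_neq0; rewrite /x /orient.
- apply: (mulfI x_neq0); rewrite /= /x /orient; field.
  by move: x_neq0; rewrite /x /orient.
Qed.

Variables (n : nat) (v : 'I_n -> R * R).
Hypothesis hv : convex_clockwise v.
Implicit Types (i j k l r : 'I_n) (T A B : {set 'I_n * 'I_n}).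

Lemma orient_inside i j k : (i < k < j)%N -> 0 < orient (v i) (v j) (v k).
Proof.
by move=> /hv; rewrite orient_rot orient_swap orient_rot orient_rot oppr_lt0.
Qed.

Lemma orient_outside i j k : (i < j)%N -> (k < i)%N || (j < k)%N ->
  orient (v i) (v j) (v k) < 0.
Proof.
move=> ij /orP[ki|jk]; last by apply: hv; rewrite ij.
by rewrite -orient_rot; apply: hv; rewrite ki.
Qed.

Lemma orient_ge0 i j k : (i <= k <= j)%N -> 0 <= orient (v i) (v j) (v k).
Proof.
move=> /andP[]; rewrite leq_eqVlt => /predU1P[/ord_inj->|ik].
  by rewrite (orient_refl _ _).1.
rewrite leq_eqVlt => /predU1P[/ord_inj->|kj]; first by rewrite (orient_refl _ _).2.
by apply/ltW/orient_inside; rewrite ik.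
Qed.

Lemma orient_le0 i j k : (i < j)%N -> (k <= i)%N || (j <= k)%N ->
  orient (v i) (v j) (v k) <= 0.
Proof.
move=> ij; rewrite (leq_eqVlt k) (leq_eqVlt j).
case/orP => /predU1P[/ord_inj e|lt].
- by rewrite e (orient_refl _ _).1.
- by apply/ltW/orient_outside; rewrite ?lt.
- by rewrite e (orient_refl _ _).2.
- by apply/ltW/orient_outside; rewrite ?lt ?orbT.
Qed.

Lemma interleave_crossing (d e : 'I_n * 'I_n) : interleave d e -> crossing v d e.
Proof.
case: d e => [a b] [c d] /and3P[/= ac cb bd].
apply: open_segments_meet => /=.
- by apply: orient_outside; lia.
- by apply: orient_inside; lia.
- by apply: orient_inside; lia.
- by apply: orient_outside; lia.
Qed.

Lemma crossing_interleave (d e : 'I_n * 'I_n) : (d.1 < d.2)%N -> (e.1 < e.2)%N ->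
  d != e -> crossing v d e -> interleave d e || interleave e d.
Proof.
case: d e => [a b] [c d] /= ab cd ne [p [[t [t01 p1 p2]] [u [u01 q1 q2]]]].
rewrite /interleave /=; apply: contraT => nint.
have p0 : orient (v a) (v b) p = 0.
  by rewrite (orient_convex _ _ p1 p2) (orient_refl _ _).1 (orient_refl _ _).2; ring.
have {ne} : ~~ ((a == c :> nat) && (b == d :> nat)).
  by move: ne; rewrite xpair_eqE -!val_eqE.
move: p0; rewrite (orient_convex _ _ q1 q2) => p0 ne.
have [u0 u1] := andP u01.
have {}u1 : 0 < 1 - u by rewrite subr_gt0.
have [ins|out] := boolP [&& a <= c & d <= b]%N.
  have hc : 0 <= orient (v a) (v b) (v c) by apply: orient_ge0; lia.
  have hd : 0 <= orient (v a) (v b) (v d) by apply: orient_ge0; lia.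
  have := mulr_ge0 (ltW u1) hc; have := mulr_ge0 (ltW u0) hd.
  have [s1|s1] := boolP (a < c)%N.
    have : 0 < orient (v a) (v b) (v c) by apply: orient_inside; lia.
    by move/(mulr_gt0 u1); lra.
  have : 0 < orient (v a) (v b) (v d) by apply: orient_inside; lia.
  by move/(mulr_gt0 u0); lra.
have hc : orient (v a) (v b) (v c) <= 0 by apply: orient_le0 => //; lia.
have hd : orient (v a) (v b) (v d) <= 0 by apply: orient_le0 => //; lia.
have := mulr_ge0_le0 (ltW u1) hc; have := mulr_ge0_le0 (ltW u0) hd.
have [s1|s1] := boolP ((c < a) || (b < c))%N.
  have : (1 - u) * orient (v a) (v b) (v c) < 0 by rewrite pmulr_rlt0 ?orient_outside.
  by lra.
have : u * orient (v a) (v b) (v d) < 0 by rewrite pmulr_rlt0 ?orient_outside //; lia.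
by lra.
Qed.

Lemma full_cover i j T p : (i.+1 < j)%N -> T \in full i j ->
    (forall k k', k' = k.+1 :> nat -> (i <= k)%N -> (k' <= j)%N ->
       orient (v k) (v k') p <= 0) ->
    orient (v j) (v i) p <= 0 ->
  exists2 t, t \in tri T & in_triangle v t p.
Proof.
have [m le_m] := ubnP (j - i)%N.
elim: m i j T le_m => // m IH i j T; rewrite ltnS => le_m lt_ij fT sides base.
have [k [A [B [ikj fA fB ->]]]] := full_split lt_ij fT.
rewrite (tri_glue ikj) //.
have [ik|ik] := leP (orient (v i) (v k) p) 0; last first.
  have lt_ik : (i.+1 < k)%N.
    rewrite ltnNge; apply/negP => le.
    by have : orient (v i) (v k) p <= 0; [apply: sides; lia | lra].
  have [|k1 k2 ek h1 h2||t tA pt] := IH i k A _ lt_ik fA.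
  - lia.
  - by apply: sides; lia.
  - by rewrite orient_swap oppr_le0 ltW.
  by exists t; rewrite // !in_setU tA orbT.
have [kj|kj] := leP (orient (v k) (v j) p) 0; last first.
  have lt_kj : (k.+1 < j)%N.
    rewrite ltnNge; apply/negP => le.
    by have : orient (v k) (v j) p <= 0; [apply: sides; lia | lra].
  have [|k1 k2 ek h1 h2||t tB pt] := IH k j B _ lt_kj fB.
  - lia.
  - by apply: sides; lia.
  - by rewrite orient_swap oppr_le0 ltW.
  by exists t; rewrite // !in_setU tB !orbT.
by exists (i, k, j); rewrite // in_setU in_set1 eqxx.
Qed.

Lemma interior_inside i j l (m : 'I_n) r p :
    [&& i <= l, l < m, m < r & r <= j]%N ->
  in_triangle_interior v (l, m, r) p -> 0 < orient (v i) (v j) p.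
Proof.
move=> /and4P[il lm mr rj] [h1 h2 h3].
have o := @hv l m r ltac:(lia).
have hl := mulr_le0_ge0 (ltW h2) (@orient_ge0 i j l ltac:(lia)).
have hm : orient (v r) (v l) p * orient (v i) (v j) (v m) < 0.
  by rewrite nmulr_rlt0 // orient_inside //; lia.
have hr := mulr_le0_ge0 (ltW h1) (@orient_ge0 i j r ltac:(lia)).
by rewrite -(nmulr_rlt0 _ o) orient_barycentric; lra.
Qed.

Lemma interior_outside i j l (m : 'I_n) r p : (i < j)%N -> (l < m < r)%N ->
    ~~ (i < l < j)%N -> ~~ (i < m < j)%N -> ~~ (i < r < j)%N ->
  in_triangle_interior v (l, m, r) p -> orient (v i) (v j) p < 0.
Proof.
move=> ij lmr nl nm nr [h1 h2 h3].
have o := hv lmr.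
have term k x : x < 0 -> ~~ (i < k < j)%N -> 0 <= x * orient (v i) (v j) (v k).
  by move=> x0 nk; apply: mulr_le0; [exact: ltW | apply: orient_le0 => //; lia].
have strict k x : x < 0 -> (k < i)%N || (j < k)%N -> 0 < x * orient (v i) (v j) (v k).
  by move=> x0 nk; rewrite nmulr_rgt0 // orient_outside.
have tr := term _ _ h1 nr; have tl := term _ _ h2 nl; have tm := term _ _ h3 nm.
rewrite -(nmulr_rgt0 _ o) orient_barycentric.
have [/(strict _ _ h2)|ol] := boolP ((l < i) || (j < l))%N; first by lra.
have [/(strict _ _ h3)|om] := boolP ((m < i) || (j < m))%N; first by lra.
by have /(strict _ _ h1) : ((r < i) || (j < r))%N; [lia | lra].
Qed.

Lemma full_interiors_disjoint i j T p t t' : (i < j)%N -> T \in full i j ->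
    t \in tri T -> t' \in tri T ->
    in_triangle_interior v t p -> in_triangle_interior v t' p -> t = t'.
Proof.
have [m le_m] := ubnP (j - i)%N.
elim: m i j T t t' le_m => // m IH i j T t t'; rewrite ltnS => le_m lt_ij fT.
have [lt|le] := ltnP i.+1 j; last first.
  have e : (j = i.+1 :> nat) by lia.
  by move: fT; rewrite full_side // => /eqP->; rewrite tri0 inE.
have [k [A [B [ikj fA fB ->]]]] := full_split lt fT.
have /fullP[_ sA _] := fA; have /fullP[_ sB _] := fB.
rewrite (tri_glue ikj) // !in_setU !in_set1.
have sepA t1 :
    t1 \in tri A -> in_triangle_interior v t1 p -> 0 < orient (v i) (v k) p.
  by case: t1 => [[l x] r] /(tri_within sA)/interior_inside; apply.
have sepB t1 :
    t1 \in tri B -> in_triangle_interior v t1 p -> 0 < orient (v k) (v j) p.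
  by case: t1 => [[l x] r] /(tri_within sB)/interior_inside; apply.
have sepB' t1 :
    t1 \in tri B -> in_triangle_interior v t1 p -> orient (v i) (v k) p < 0.
  case: t1 => [[l x] r] /(tri_within sB) h.
  by apply: interior_outside; lia.
have mainA : in_triangle_interior v (i, k, j) p -> orient (v i) (v k) p < 0 by case.
have mainB : in_triangle_interior v (i, k, j) p -> orient (v k) (v j) p < 0 by case.
case/or3P => [/eqP->|tA|tB] /or3P[/eqP->|tA'|tB'] // pt pt'.
- by have := lt_trans (sepA _ tA' pt') (mainA pt); rewrite ltxx.
- by have := lt_trans (sepB _ tB' pt') (mainB pt); rewrite ltxx.
- by have := lt_trans (sepA _ tA pt) (mainA pt'); rewrite ltxx.
- by apply: (IH i k A) => //; lia.
- by have := lt_trans (sepA _ tA pt) (sepB' _ tB' pt'); rewrite ltxx.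
- by have := lt_trans (sepB _ tB pt) (mainB pt'); rewrite ltxx.
- by have := lt_trans (sepA _ tA' pt') (sepB' _ tB pt); rewrite ltxx.
by apply: (IH k j B) => //; lia.
Qed.

End Geometry.

(** * Triangulations as full dissections *)

Section Triangulations.
Variables (R : realType) (n : nat) (v : 'I_n -> R * R).
Hypotheses (n_ge4 : (4 <= n)%N) (hv : convex_clockwise v).
Variables i0 i1 : 'I_n.
Hypotheses (i0E : i0 = 0%N :> nat) (i1E : i1 = n.-1 :> nat).
Implicit Types (T U : {set 'I_n * 'I_n}).

Lemma sideE (a b : 'I_n) :
  side a b = (b == a.+1 :> nat) || ((a, b) == (i0, i1)).
Proof. by rewrite /side xpair_eqE -!val_eqE /= i0E i1E. Qed.

Lemma diagonalE d : diagonal d = (d \in within i0 i1) && (d != (i0, i1)).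
Proof.
case: d => a b; rewrite /diagonal sideE mem_within /=.
have := ltn_ord a; have := ltn_ord b; case: (_ == (i0, i1)); lia.
Qed.

Lemma edge_chord T a b : edge T a b = chord ((i0, i1) |: T) a b.
Proof. by rewrite /edge /chord sideE in_setU1 orbA. Qed.

Lemma triangles_tri T : triangles T = tri ((i0, i1) |: T).
Proof. by apply/setP => -[[l m] r]; rewrite !inE !edge_chord. Qed.

Lemma is_triangulationE T :
  is_triangulation v T <->
  (i0, i1) \notin T /\ (i0, i1) |: T \in full i0 i1.
Proof.
have i01 : (i0.+1 < i1)%N by lia.
have card1 : (i1 - i0).-1 = (n - 3).+1 by lia.
split=> [[diag cT nc _ _]|[e0 fT]].
  have e0 : (i0, i1) \notin T.
    by apply/negP => /diag; rewrite diagonalE eqxx andbF.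
  split=> //; apply/fullP; split; last by rewrite cardsU1 e0 cT card1.
    apply/noncrossingP => a b c d; rewrite !in_setU1.
    have la := ltn_ord a; have lb := ltn_ord b.
    have lc := ltn_ord c; have ld := ltn_ord d.
    rewrite !xpair_eqE -!val_eqE /=.
    case/orP => [ab|abT] /orP[cd|cdT]; try lia.
    apply/negP => int; apply: (nc _ _ abT cdT).
      by rewrite xpair_eqE -!val_eqE /=; lia.
    exact: interleave_crossing.
  apply/subsetP => d; rewrite in_setU1 => /predU1P[->|/diag].
    by rewrite mem_within; lia.
  by rewrite diagonalE => /andP[].
have /fullP[/noncrossingP nc sT cU] := fT.
have diag d : d \in T -> diagonal d.
  move=> dT; rewrite diagonalE (subsetP sT) ?in_setU1 ?dT ?orbT //.
  by apply: contraNneq e0 => <-.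
split=> //.
- by move: cU; rewrite cardsU1 e0 card1 => -[].
- move=> [a b] [c d] abT cdT ne cr.
  have /andP[lab _] := diag _ abT; have /andP[lcd _] := diag _ cdT.
  have abU : (a, b) \in (i0, i1) |: T by rewrite in_setU1 abT orbT.
  have cdU : (c, d) \in (i0, i1) |: T by rewrite in_setU1 cdT orbT.
  have := crossing_interleave hv lab lcd ne cr.
  by rewrite /interleave /= (negbTE (nc _ _ _ _ abU cdU))
    (negbTE (nc _ _ _ _ cdU abU)).
- by rewrite triangles_tri (card_tri _ fT); lia.
rewrite triangles_tri; split=> [p inp|p t t' tT t'T].
  apply: (full_cover i01 fT) => [k k' e _ _|].
    have -> : k' = ordS k by apply: ord_inj; rewrite /= modn_small -e.
    exact: inp.
  have -> : i0 = ordS i1; last exact: inp.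
  by apply: ord_inj; rewrite /= i0E i1E prednK ?modnn //; lia.
by apply: (full_interiors_disjoint hv _ fT) => //; lia.
Qed.

Lemma sum_triangulations (V : nmodType) (X : {set 'I_n * 'I_n} -> V) :
  \sum_(T in triangulations v) X T = \sum_(U in full i0 i1) X (U :\ (i0, i1)).
Proof.
have tE T : (T \in triangulations v) =
    ((i0, i1) \notin T) && ((i0, i1) |: T \in full i0 i1).
  by rewrite inE; apply/asboolP/andP => /is_triangulationE.
rewrite (reindex_onto (fun U => U :\ (i0, i1)) (fun T => (i0, i1) |: T)); last first.
  by move=> T; rewrite tE => /andP[e0 _]; rewrite setU1K.
apply: eq_bigl => U; rewrite tE setD11 /=.
apply/andP/idP => [[+ /eqP e]|fU]; first by rewrite e.
by rewrite setD1K ?fU // full_base //; lia.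
Qed.

End Triangulations.

Theorem lemma3 (R : realType) (w : R[i]) (n : nat) (hn : (4 <= n)%N)
    (v : 'I_n -> R * R) (hv : convex_clockwise v) :
  uniform_expectation (triangulations v) (total_weight w (n := n)) =
    - ((n%:R - 1) * (2 * w ^+ (n - 2)%N + 3 * w)) / (2 * (2 * n%:R - 5))
    + 3 * w / catalan R (n - 2)%N
      * \sum_(0 <= j < (n - 3).+1)
          w ^+ j * catalan R j * ('C(2 * n - 6 - 2 * j, n - 3 - j))%:R
    - w / (2 * catalan R (n - 2)%N)
      * \sum_(0 <= j < (n - 3).+1)
          w ^+ j * catalan R j * ('C(2 * n - 4 - 2 * j, n - 2 - j))%:R.
Proof.
have n_gt0 : (0 < n)%N by lia.
have n1_lt : (n.-1 < n)%N by lia.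
pose i0 := Ordinal n_gt0; pose i1 := Ordinal n1_lt.
have i0E : i0 = 0%N :> nat by [].
have i1E : i1 = n.-1 :> nat by [].
have sumE := sum_triangulations hn hv i0E i1E.
have cardE : #|triangulations v|%:R = catalan R (n - 2)%N.
  rewrite -sum1_card sumE sum1_card card_full //=; try lia.
  have -> : (n.-1 - 0 = (n - 2).+1)%N by lia.
  by rewrite coef_catalan_polyS //; lia.
rewrite /uniform_expectation cardE sumE.
have -> : \sum_(U in full i0 i1) total_weight w (U :\ (i0, i1)) =
    \sum_(U in full i0 i1)
      \sum_(t in tri U) (let: (l, j, r) := t in weight w l j r).
  apply: eq_bigr => U fU.
  rewrite /total_weight (triangles_tri i0E i1E).
  by rewrite setD1K // full_base //=; lia.
rewrite (@sum_full_outer _ n _ w) //=; try lia.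
- exact: total_weight_coef.
- move=> i k j ikj ij; rewrite /weight /gap_weight /perimeter_sides /side.
  have ltj := ltn_ord j.
  by congr (if _ then _ else _); lia.
move=> k ikj; rewrite /weight /perimeter_sides /side /=.
case: ifP => h1; case: ifP => h2 //; lia.
Qed.
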